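(* Let $(\mathcal{A}_n(x))_{n\ge 0}$ be a sequence of Appell polynomials defined by $\sum_{n\ge0}\mathcal{A}_n(x)\frac{t^n}{n!}=F(t)e^{xt}$ with $F(0)=1$, where $\mathcal{A}_n:=\mathcal{A}_n(0)$ is a nonnegative integer for every $n$, so that $\mathcal{A}_n(x)=\sum_{k=0}^n\binom{n}{k}\mathcal{A}_{n-k}x^k\in\mathbb{Z}[x]$. Let $p$ be an odd prime and suppose there is an integer $t$ such that $\mathcal{A}_{n+p}\equiv t\,\mathcal{A}_n \pmod p$ for every integer $n\ge 0$. Let $m\ge 0$ and $s\ge 1$ be integers. Then for every polynomial $f(y)=\sum_{k} c_k y^k\in\mathbb{Z}[y]$, $$\sum_k c_k\,\mathcal{A}_{k+mp^s}(x)\equiv \left(x^{p^s}+t\right)^m\sum_k c_k\,\mathcal{A}_k(x)\pmod{p}.$$ Equivalently (taking $f(y)=y^n$), for every integer $n\ge 0$, $$\mathcal{A}_{n+mp^s}(x)\equiv \left(x^{p^s}+t\right)^m\mathcal{A}_n(x)\pmod p,$$ and in particular $\mathcal{A}_{mp^s}(x)\equiv \left(x^{p^s}+t\right)^m \pmod p$.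
   Context: A congruence $P(x)\equiv Q(x)\pmod p$ between polynomials with integer coefficients means that every coefficient of $P(x)-Q(x)$ is divisible by $p$. In umbral notation, with the umbra $\mathbf{A}$ defined by $\mathbf{A}^n=\mathcal{A}_n$ (extended linearly), the first congruence reads $(\mathbf{A}+x)^{mp^s}f(\mathbf{A}+x)\equiv (x^{p^s}+t)^m f(\mathbf{A}+x)$, since $(\mathbf{A}+x)^n=\mathcal{A}_n(x)$. *)

(* Defs.v *)
From HB Require Import structures.
From mathcomp Require Import all_boot all_order all_algebra.

Set Implicit Arguments.
Unset Strict Implicit.
Unset Printing Implicit Defensive.

Import Order.TTheory GRing.Theory Num.Theory.
Local Open Scope ring_scope.

(* A formal power series [\sum_n G n t^n] is given by its coefficient
   sequence [G : nat -> R]; this is the Cauchy product. *)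
Definition fps_mul (R : nzRingType) (G H : nat -> R) : nat -> R :=
  fun n => \sum_(i < n.+1) G i * H (n - i)%N.

(* [\sum_n A_n t^n / n!], a power series in t over K[x]. *)
Definition egf (K : fieldType) (A : nat -> {poly K}) : nat -> {poly K} :=
  fun n => (n`!%:R)^-1 *: A n.

(* [e^(xt)], where x is the polynomial variable ['X] of K[x]. *)
Definition exp_xt (K : fieldType) : nat -> {poly K} :=
  fun n => (n`!%:R)^-1 *: 'X^n.

(* [\sum_n A_n(x) t^n / n! = F(t) e^(xt)]. *)
Definition appell_gf (K : fieldType) (F : nat -> K) (A : nat -> {poly K})
    : Prop :=
  forall n, egf A n = fps_mul (fun k => (F k)%:P) (@exp_xt K) n.

(* The integer polynomials P' and Q' are unique, as K has characteristic 0;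
   in particular the congruence asserts that P and Q lie in Z[x]. *)
Definition poly_eqmod (K : numFieldType) (p : nat) (P Q : {poly K}) : Prop :=
  exists P' Q' : {poly int},
    [/\ P = map_poly intr P', Q = map_poly intr Q'
      & forall i : nat, (p %| (P' - Q')`_i)%Z].

(* Main.v *)
Require Import Defs.
From HB Require Import structures.
From mathcomp Require Import all_boot all_order all_algebra all_field.

Set Implicit Arguments.
Unset Strict Implicit.
Unset Printing Implicit Defensive.

Import Order.TTheory GRing.Theory Num.Theory.
Local Open Scope ring_scope.

(** In umbral terms [A_n(x) = L((y + x)^n)], where [L] is the [R[x]]-linear
functional on [R[x][y]] with [L(y^n) = a_n]. Modulo p the hypothesis reads
[L(y^p g) = t L(g)], so Fermat's little theorem gives
[L(y^(p^s) g) = t^(p^(s-1)) L(g) = t L(g)]; as [(y + x)^(p^s) = y^(p^s) + x^(p^s)]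
modulo p, multiplying the argument of [L] by [(y + x)^(p^s)] multiplies its value
by [x^(p^s) + t]. *)

Definition umbral_eval (R : comNzRingType) (a : nat -> R) (g : {poly R}) : R :=
  \sum_(i < size g) g`_i * a i.

Definition appell_poly (R : nzRingType) (a : nat -> R) (n : nat) : {poly R} :=
  \sum_(k < n.+1) ('C(n, k)%:R * a (n - k)%N) *: 'X^k.

Section UmbralEval.

Variables (R : comNzRingType) (a : nat -> R).
Implicit Types g h : {poly R}.

(** Coefficients beyond the size vanish, so polynomials of different sizes can be summed over one
    common range; linearity then becomes a termwise identity. *)
Lemma umbral_eval_widen (n : nat) g : (size g <= n)%N ->
  umbral_eval a g = \sum_(i < n) g`_i * a i.
Proof.
move=> le_gn; rewrite /umbral_eval (big_ord_widen n (fun i => g`_i * a i)) //.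
rewrite big_mkcond; apply: eq_bigr => i _; case: ltnP => // le_gi.
by rewrite nth_default ?mul0r.
Qed.

Lemma umbral_eval_is_scalar : scalar (umbral_eval a).
Proof.
move=> c g h; set n := maxn (size g) (size h).
have le_gn : (size g <= n)%N by apply: leq_maxl.
have le_hn : (size h <= n)%N by apply: leq_maxr.
have le_sn : (size (c *: g + h)%R <= n)%N.
  apply: leq_trans (size_polyD _ _) _; rewrite geq_max le_hn andbT.
  exact: leq_trans (size_scale_leq _ _) le_gn.
rewrite !(@umbral_eval_widen n) // mulr_sumr -big_split.
by apply: eq_bigr => i _; rewrite coefD coefZ mulrDl mulrA.
Qed.

HB.instance Definition _ :=
  GRing.isLinear.Build R {poly R} R *%R (umbral_eval a) umbral_eval_is_scalar.

Lemma umbral_evalXn (n : nat) : umbral_eval a 'X^n = a n.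
Proof.
rewrite /umbral_eval size_polyXn big_ord_recr /= coefXn eqxx mul1r big1 ?add0r //.
by move=> i _; rewrite coefXn ltn_eqF ?mul0r.
Qed.

Lemma umbral_eval_mulXn (q : nat) (t : R) g :
    (forall n, a (n + q)%N = t * a n) ->
  umbral_eval a ('X^q * g) = t * umbral_eval a g.
Proof.
move=> a_q; rewrite -[g]coefK poly_def mulr_sumr !linear_sum mulr_sumr.
apply: eq_bigr => i _.
by rewrite -scalerAr !linearZ /= -exprD !umbral_evalXn addnC a_q mulrCA.
Qed.

End UmbralEval.

(** Binomial expansion in [R[x][y]]: the outer ['X] is the umbra [y], while ['X%:P] is [x], a scalar
    that leaves the functional by linearity. *)
Lemma appell_poly_umbral (R : comNzRingType) (a : nat -> R) (n : nat) :
  appell_poly a n = umbral_eval (fun k => (a k)%:P) (('X + 'X%:P) ^+ n).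
Proof.
rewrite exprDn linear_sum; apply: eq_bigr => i _.
rewrite linearMn -polyC_exp [_ * _%:P]mulrC mul_polyC linearZ /= umbral_evalXn.
by rewrite [_ * _%:P]mulrC mul_polyC -scaler_nat scalerA.
Qed.

Lemma iter_shift (R : comNzRingType) (a : nat -> R) (q : nat) (t : R) (k n : nat) :
  (forall n, a (n + q)%N = t * a n) -> a (n + k * q)%N = t ^+ k * a n.
Proof.
move=> a_q; elim: k n => [|k IHk] n; first by rewrite addn0 expr0 mul1r.
by rewrite mulSn addnA IHk a_q mulrA -exprSr.
Qed.

Lemma Fp_expXp (p : nat) (t : 'F_p) (k : nat) : prime p -> t ^+ (p ^ k) = t.
Proof.
move=> p_pr; elim: k => [|k IHk]; first by rewrite expr1.
by rewrite expnS mulnC exprM IHk -[in X in _ ^+ X](card_Fp p_pr) expf_card.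
Qed.

Lemma appell_poly_Fp (p : nat) (a : nat -> 'F_p) (t : 'F_p) (m s n : nat) :
    prime p -> (0 < s)%N -> (forall n, a (n + p)%N = t * a n) ->
  appell_poly a (n + m * p ^ s) = ('X^(p ^ s) + t%:P) ^+ m * appell_poly a n.
Proof.
move=> p_pr s_gt0 a_p.
have a_q k : (a (k + p ^ s)%N)%:P = t%:P * (a k)%:P.
  (* As [s] is positive, a shift by [p ^ s] is [p ^ s.-1] shifts by [p]. *)
  by rewrite -(prednK s_gt0) expnSr (iter_shift _ _ a_p) Fp_expXp // polyCM.
have p_char : p \in [pchar {poly {poly 'F_p}}] by rewrite !pchar_poly pchar_Fp.
elim: m n => [|m IHm] n; first by rewrite addn0 mul1r.
(* The induction hypothesis at [n + p ^ s] leaves only the case of a single factor. *)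
rewrite mulSn addnA IHm exprSr -mulrA; congr (_ * _).
rewrite !appell_poly_umbral addnC exprD exprDn_pchar; last first.
  by rewrite pnatX pnatE ?p_char.
rewrite mulrDl linearD /= (umbral_eval_mulXn _ a_q) -polyC_exp.
by rewrite (mul_polyC 'X^_) linearZ /= -mulrDl addrC.
Qed.

Lemma map_appell_poly (R S : nzRingType) (f : {rmorphism R -> S})
    (a : nat -> R) (n : nat) :
  map_poly f (appell_poly a n) = appell_poly (f \o a) n.
Proof.
rewrite /appell_poly rmorph_sum; apply: eq_bigr => k _.
by rewrite /= map_polyZ map_polyXn rmorphM rmorph_nat.
Qed.

(** Comparing coefficients of the generating functions expresses [A n] through [F]; evaluating at 0
    gives [A_k(0) = k! F_k], which eliminates [F]. Factorials are invertible in characteristic 0. *)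
Lemma appell_gf_poly (K : numFieldType) (F : nat -> K) (A : nat -> {poly K}) n :
  appell_gf F A -> A n = appell_poly (fun k => (A k).[0]) n.
Proof.
have factK k : (k`!%:R : K) \is a GRing.unit.
  by rewrite unitfE pnatr_eq0 -lt0n fact_gt0.
move=> hA.
have AE k : A k = \sum_(i < k.+1) (k`!%:R / (k - i)`!%:R * F i) *: 'X^(k - i).
  have /(congr1 (fun q => k`!%:R *: q)) := hA k.
  rewrite /egf /fps_mul /exp_xt scalerA divrr // scale1r => ->.
  rewrite scaler_sumr; apply: eq_bigr => i _.
  by rewrite mul_polyC !scalerA -mulrA [F i * _]mulrC mulrA.
have A0 k : (A k).[0] = k`!%:R * F k.
  (* At 0 only the term [i = k] survives, the others having a positive power of [x]. *)
  rewrite AE horner_sum big_ord_recr /= subnn big1 ?add0r => [|i _].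
    by rewrite hornerZ hornerXn mulr1 fact0 divr1.
  by rewrite hornerZ hornerXn expr0n subn_eq0 leqNgt ltn_ord mulr0.
rewrite AE /appell_poly (reindex_inj rev_ord_inj) /=; apply: eq_bigr => i _.
have le_in : (i <= n)%N by rewrite -ltnS.
rewrite subSS subKn // A0 -(bin_fact le_in) !natrM.
by congr (_ *: _); rewrite [i`!%:R * _]mulrC mulrA mulrK // mulrA.
Qed.

(** An integer is divisible by [p] exactly when its image in ['F_p] is zero, so congruences in
    [Z[x]] can be proved as equalities in [F_p[x]]. *)
Lemma poly_eqmod_Fp (K : numFieldType) (p : nat) (P Q : {poly int}) :
    prime p ->
    map_poly (intr : int -> 'F_p) P = map_poly intr Q ->
  poly_eqmod p (map_poly (intr : int -> K) P) (map_poly intr Q).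
Proof.
move=> p_pr eqPQ; exists P, Q; split=> // i.
rewrite (dvdz_pcharf (pchar_Fp p_pr)) coefB rmorphB /= subr_eq0 -!coef_map.
by rewrite /= eqPQ.
Qed.

Theorem theorem1 (K : numFieldType) (F : nat -> K) (A : nat -> {poly K})
    (hF0 : F 0%N = 1) (hA : appell_gf F A)
    (a : nat -> nat) (ha : forall n : nat, (A n).[0] = (a n)%:R)
    (p : nat) (hp : prime p) (hodd : odd p)
    (t : int)
    (ht : forall n : nat, ((a (n + p)%N)%:Z = t * (a n)%:Z %[mod p])%Z)
    (m s : nat) (hs : (1 <= s)%N) :
  [/\ (forall n : nat,
         A n = \sum_(k < n.+1) ('C(n, k) * a (n - k))%N%:R *: 'X^k),
      (forall f : {poly int},
         poly_eqmod p
           (\sum_(k < size f) (f`_k)%:~R *: A (k + m * p ^ s)%N)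
           (('X^(p ^ s)%N + t%:~R%:P) ^+ m * \sum_(k < size f) (f`_k)%:~R *: A k)),
      (forall n : nat,
         poly_eqmod p (A (n + m * p ^ s)%N)
           (('X^(p ^ s)%N + t%:~R%:P) ^+ m * A n))
    & poly_eqmod p (A (m * p ^ s)%N) (('X^(p ^ s)%N + t%:~R%:P) ^+ m)].
Proof.
(* [B n] is the integral form of [A n]: it maps to [A n] over [K] and can also be reduced to ['F_p],
   which links the two settings. *)
pose B : nat -> {poly int} := appell_poly (fun k => (a k)%:Z).
have A_explicit n :
    A n = \sum_(k < n.+1) ('C(n, k) * a (n - k))%N%:R *: 'X^k.
  rewrite (appell_gf_poly n hA); apply: eq_bigr => k _.
  by rewrite ha natrM.
have AB n : A n = map_poly intr (B n).
  rewrite map_appell_poly A_explicit; apply: eq_bigr => k _.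
  by rewrite natrM.
pose c : {poly int} := 'X^(p ^ s) + t%:P.
have mapc (R : nzRingType) : map_poly intr c = 'X^(p ^ s) + (t%:~R : R)%:P.
  by rewrite rmorphD /= map_polyXn map_polyC.
have B_Fp n : map_poly (intr : int -> 'F_p) (B (n + m * p ^ s)%N) =
    map_poly intr (c ^+ m * B n).
  rewrite rmorphM rmorphXn /= mapc !map_appell_poly.
  apply: appell_poly_Fp => // k /=.
  apply/eqP; rewrite -rmorphM -subr_eq0 -rmorphB.
  by rewrite -(dvdz_pcharf (pchar_Fp hp)) -eqz_mod_dvd; apply/eqP/ht.
(* The shift [r] is used twice: [m * p ^ s] for the left side of the congruence, 0 for the right. *)
have sumAB (f : {poly int}) (r : nat) :
    \sum_(k < size f) (f`_k)%:~R *: A (k + r)%N =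
    map_poly intr (\sum_(k < size f) f`_k *: B (k + r)%N).
  by rewrite rmorph_sum; apply: eq_bigr => k _; rewrite AB /= map_polyZ.
have modA n : poly_eqmod p (A (n + m * p ^ s)%N)
    (('X^(p ^ s)%N + t%:~R%:P) ^+ m * A n).
  by rewrite !AB -mapc -rmorphXn -rmorphM; apply: poly_eqmod_Fp.
split=> // [f|].
  have := sumAB f 0%N; under eq_bigr do rewrite addn0; move=> ->.
  rewrite sumAB -mapc -rmorphXn -rmorphM; apply: poly_eqmod_Fp => //.
  rewrite mulr_sumr !rmorph_sum; apply: eq_bigr => k _.
  by rewrite /= addn0 -scalerAr !map_polyZ /= B_Fp.
(* The normalization [F 0 = 1] turns the case [n = 0] into the last claim. *)
have A0 : A 0%N = 1.
  have := hA 0%N; rewrite /egf /fps_mul big_ord1 hF0 mul1r /exp_xt.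
  by rewrite subnn fact0 invr1 !scale1r.
by have := modA 0%N; rewrite A0 mulr1.
Qed.
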